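(* Let $T>0$, $A_0,A_1,\dots,A_m\in\mathbb R^{n\times n}$, $C\in\mathbb R^{p\times n}$, $u=(u_1,\dots,u_m)^\top\in L^2([0,T];\mathbb R^m)$, and let $\Phi(t,t_0)$, $0\le t_0\le t\le T$, be the fundamental solution determined by $$\Phi(t,t_0)=I+\int_{t_0}^tA_0\Phi(s,t_0)\,\mathrm ds+\sum_{i=1}^m\int_{t_0}^tA_i\Phi(s,t_0)u_i(s)\,\mathrm ds .$$ Let $Q$ be the observability Gramian $Q=\int_0^T Z^*(t,C^\top C)\,\mathrm dt$ and let $(q_i)_{i=1}^n$ be an orthonormal basis of $\mathbb R^n$ consisting of eigenvectors of $Q$. Then, for each $i\in\{1,\dots,n\}$ and each $0\le t_0<T$, $$\int_{t_0}^T\|C\Phi(t,t_0)q_i\|^2\,\mathrm dt\le\mu_i\exp\left\{\|u\|_{L^2([0,T])}^2\right\},$$ where $\mu_i$ is the eigenvalue of $Q$ associated with $q_i$.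
   Context: $Z^*(t,C^\top C)$, $t\in[0,T]$, denotes the solution of the matrix differential equation $$\dot Z^*(t)=A_0^\top Z^*(t)+Z^*(t)A_0+\sum_{i=1}^m A_i^\top Z^*(t)A_i,\qquad Z^*(0)=C^\top C.$$ $I$ is the identity matrix, $\|\cdot\|$ is the Euclidean norm and $\|u\|_{L^2([0,T])}^2=\int_0^T\|u(t)\|^2\,\mathrm dt$. No stability assumption is made on $A_0,\dots,A_m$. *)

(* Defs.v *)
From HB Require Import structures.
From mathcomp Require Import all_boot all_order all_algebra.
From mathcomp Require Import all_classical all_reals all_analysis.

Set Implicit Arguments.
Unset Strict Implicit.
Unset Printing Implicit Defensive.

Import Order.TTheory GRing.Theory Num.Theory.
Import numFieldNormedType.Exports.

Local Open Scope classical_set_scope.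
Local Open Scope ring_scope.

Local Notation leb := lebesgue_measure.

(* The library norm on matrices is the sup norm, hence a separate definition. *)
Definition enorm (R : realType) (k : nat) (v : 'cV[R]_k) : R :=
  Num.sqrt (\sum_(i < k) v i 0 ^+ 2).

Definition mx_integrable (R : realType) (k l : nat) (D : set R)
    (F : R -> 'M[R]_(k, l)) : Prop :=
  forall i j, leb.-integrable D (fun s => (F s i j)%:E).

Definition mx_integral (R : realType) (k l : nat) (D : set R)
    (F : R -> 'M[R]_(k, l)) : 'M[R]_(k, l) :=
  \matrix_(i, j) Rintegral leb D (fun s => F s i j).

(* Derivative relative to D; one-sided at the endpoints when D is an interval. *)
Definition mx_is_derive_within (R : realType) (k l : nat) (D : set R)
    (F : R -> 'M[R]_(k, l)) (t : R) (dF : 'M[R]_(k, l)) : Prop :=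
  forall i j,
    (fun s => (s - t)^-1 * (F s i j - F t i j)) @ within D t^' --> dF i j.

(* u represents an element of L^2([0,T]; R^m). *)
Definition L2_control (R : realType) (m : nat) (T : R) (u : R -> 'cV[R]_m)
    : Prop :=
  (forall i, measurable_fun `[0, T] (fun t => u t i 0)) /\
  leb.-integrable `[0, T] (fun t => (enorm (u t) ^+ 2)%:E).

Definition L2_sqnorm (R : realType) (m : nat) (T : R) (u : R -> 'cV[R]_m)
    : R :=
  Rintegral leb `[0, T] (fun t => enorm (u t) ^+ 2).

(* Integrability of the integrands is what gives the integral equation a
   meaning: Rintegral is total. It makes Phi(., t0) continuous on [t0, T]. *)
Definition fundamental_solution (R : realType) (n m : nat) (T : R)
    (A0 : 'M[R]_n) (A : 'I_m -> 'M[R]_n) (u : R -> 'cV[R]_m)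
    (Phi : R -> R -> 'M[R]_n) : Prop :=
  forall t t0 : R, 0 <= t0 -> t0 <= t -> t <= T ->
  [/\ mx_integrable `[t0, t] (fun s => A0 *m Phi s t0),
      forall i, mx_integrable `[t0, t]
                  (fun s => u s i 0 *: (A i *m Phi s t0)) &
      Phi t t0 = 1%:M
        + mx_integral `[t0, t] (fun s => A0 *m Phi s t0)
        + \sum_(i < m) mx_integral `[t0, t]
                         (fun s => u s i 0 *: (A i *m Phi s t0))].

Definition dual_lyapunov_solution (R : realType) (n m : nat) (T : R)
    (A0 : 'M[R]_n) (A : 'I_m -> 'M[R]_n) (Z0 : 'M[R]_n)
    (Z : R -> 'M[R]_n) : Prop :=
  Z 0 = Z0 /\
  forall t, t \in `[0, T] ->
    mx_is_derive_within `[0, T] Z t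
      (A0^T *m Z t + Z t *m A0 + \sum_(i < m) (A i)^T *m Z t *m A i).

Definition obs_gramian (R : realType) (n : nat) (T : R) (Z : R -> 'M[R]_n)
    : 'M[R]_n :=
  mx_integral `[0, T] Z.

Definition orthonormal_eigenbasis (R : realType) (n : nat) (Q : 'M[R]_n)
    (lam : 'I_n -> R) (q : 'I_n -> 'cV[R]_n) : Prop :=
  [/\ basis_of {: 'cV[R]_n} [seq q i | i : 'I_n],
      forall i j, ((q i)^T *m q j) 0 0 = (i == j)%:R &
      forall i, Q *m q i = lam i *: q i].

(* Main.v *)
Require Import Defs.
From HB Require Import structures.
From mathcomp Require Import all_boot all_order all_algebra.
From mathcomp Require Import all_classical all_reals all_analysis.
From mathcomp Require Import ring lra.

(** Write [x] for the trajectory [Phi(., t0) q], [w] for [|u|^2], and [L] for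
    the operator [L(Z) = A0^T Z + Z A0 + sum_i A_i^T Z A_i], so that
    [Z' = L(Z)].  Fix a final time [t] and follow
    [f(s) = x(s)^T Z(t - s) x(s)] for [t0 <= s <= t].  Formally,
[[
      f' = sum_i ( u_i x^T (A_i^T Z + Z A_i) x - (A_i x)^T Z (A_i x) )
]]
    since the [A0] terms cancel, and completing the square in
    [(A_i x - u_i x)^T Z (A_i x - u_i x) >= 0] bounds the right-hand side by
    [w f].  Hence [f(t) <= exp(int w) f(t0)], that is,
    [|C x(t)|^2 <= exp(||u||^2) q^T Z(t - t0) q] ([energy_bound]).  Integrating
    over [t], where the right-hand side becomes an integral over the part
    between [0] and [T - t0] of the domain that defines [Q], gives the bound
    [exp(||u||^2) q^T Q q = mu exp(||u||^2)].

    Two points need care.  The square argument needs [Z(s)] to be positive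
    semidefinite ([dual_lyapunov_psd]): an explicit Euler step maps the cone of
    such matrices into itself up to second order, so that
    [Z(s) + e exp(K s) I] cannot leave the cone.  And [u] is only square
    integrable, so that [x] is differentiable only almost everywhere.
    Differentiating [f] is avoided: between two nearby times [s < r],
    continuity of [x] alone gives
[[
      f(r) - f(s) <= f(s) int_s^r w + e (int_s^r w + (m + 2)(r - s))
]]
    ([energy_increment]), and [gronwall_increment] integrates such increments.
    Both the integration of increments and the invariance of the cone rest on
    [real_induction].

    [Z] is nowhere assumed or shown to be symmetric: only the quadratic forms
    [v^T Z v] matter. *)

Set Implicit Arguments.
Unset Strict Implicit.
Unset Printing Implicit Defensive.

Import Order.TTheory GRing.Theory Num.Theory.
Import numFieldNormedType.Exports.

Local Open Scope classical_set_scope.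
Local Open Scope ring_scope.

(** * Induction on a real interval, and continuity relative to it *)

Section RealInduction.
Context {R : realType}.
Implicit Types (a b s r : R).

(** A property that holds at [a], propagates to the right of each point where
    it holds, and passes to limits from the left, holds from [a] to [b]. *)
Lemma real_induction a b (S : R -> Prop) :
  S a ->
  (forall s, a <= s -> s < b -> S s ->
     exists2 d, 0 < d & forall r, s < r -> r < s + d -> r <= b -> S r) ->
  (forall s, a < s -> s <= b -> (forall r, a <= r -> r < s -> S r) -> S s) ->
  forall s, a <= s -> s <= b -> S s.
Proof.
move=> Sa Sopen Sclosed s0 as0 s0b.
have ab : a <= b by exact: le_trans s0b.
pose E := [set s | a <= s /\ s <= b /\ forall r, a <= r -> r <= s -> S r].
have Ea : E a.
  split=> //; split=> // r ar ra.
  by have -> : r = a by apply/eqP; rewrite eq_le ar ra.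
have supE : has_sup E by split; [exists a | exists b => s [_ []]].
set c := sup E.
have ac : a <= c by apply: ub_le_sup => //; case: supE.
have cb : c <= b by apply: ge_sup; [exists a | move=> s [_ []]].
have below r : a <= r -> r < c -> S r.
  move=> ar rc.
  have cr : 0 < c - r by rewrite subr_gt0.
  have [e [ae [eb Se]]] := sup_adherent cr supE.
  by rewrite opprB addrC subrK => /ltW re; exact: Se.
have Sc : S c.
  move: ac; rewrite le_eqVlt => /predU1P[<-//|ac].
  exact: Sclosed.
have Sle r : a <= r -> r <= c -> S r.
  by move=> ar; rewrite le_eqVlt => /predU1P[->//|]; exact: below.
suff cE : c = b by apply: Sle => //; rewrite cE.
apply/eqP; rewrite eq_le cb /= leNgt; apply/negP => cltb.
have [d d0 Sd] := Sopen c ac cltb Sc.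
pose e := Num.min (c + d / 2) b.
have ce : c < e by rewrite lt_min cltb andbT; lra.
suff /(ub_le_sup (proj2 supE)) : E e by rewrite -/c leNgt ce.
split; first by lra.
split; first by rewrite ge_min lexx orbT.
move=> r ar re; have [rc|cr] := leP r c; first exact: Sle.
move: re; rewrite le_min => /andP[re rb].
by apply: Sd => //; lra.
Qed.

Lemma within_continuous_dist (f : R -> R) a b s e :
  {within `[a, b], continuous f} -> a <= s -> s <= b -> 0 < e ->
  exists2 d, 0 < d & forall r, a <= r -> r <= b -> `|r - s| < d ->
    `|f r - f s| <= e.
Proof.
move=> /subspace_continuousP cf as_ sb e0.
have /cf : `[a, b]%classic s by rewrite /= in_itv /= as_ sb.
move=> /cvgrPdist_le/(_ _ e0); rewrite near_withinE => /nbhs_normP[d /= d0 fd].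
exists d => // r ar rb rs; rewrite distrC; apply: fd.
  by rewrite /= distrC.
by rewrite /= in_itv /= ar rb.
Qed.

Lemma dist_within_continuous (f : R -> R) a b :
  (forall s, a <= s -> s <= b -> forall e, 0 < e ->
  exists2 d, 0 < d & forall r, a <= r -> r <= b -> `|r - s| < d ->
    `|f r - f s| <= e) ->
  {within `[a, b], continuous f}.
Proof.
move=> fd; apply/subspace_continuousP => s /=; rewrite in_itv /=.
move=> /andP[as_ sb]; apply/cvgrPdist_le => e e0.
rewrite near_withinE; apply/nbhs_normP.
have [d d0 {}fd] := fd s as_ sb e e0; exists d => //= r rs.
rewrite in_itv /= => /andP[ar rb].
by rewrite distrC; apply: fd => //; rewrite distrC.
Qed.

(** A continuous function nonnegative to the left of a point is so there. *)
Lemma within_continuous_ge0_left (f : R -> R) a b s :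
  {within `[a, b], continuous f} -> a < s -> s <= b ->
  (forall r, a <= r -> r < s -> 0 <= f r) -> 0 <= f s.
Proof.
move=> cf as_ sb f0; rewrite leNgt; apply/negP => fs.
have e0 : 0 < - f s / 2 by lra.
have [d d0 fd] := @within_continuous_dist f a b s _ cf (ltW as_) sb e0.
pose r := Num.max a (s - d / 2).
have ar : a <= r by rewrite le_max lexx.
have rs : r < s by rewrite gt_max as_ /=; lra.
have sr : s - d / 2 <= r by rewrite le_max lexx orbT.
have : `|f r - f s| <= - f s / 2.
  by apply: fd => //; [lra | rewrite ltr_norml; apply/andP; split; lra].
by have := f0 r ar rs; rewrite ler_norml => ? /andP[? ?]; lra.
Qed.

End RealInduction.

Section WithinContinuity.
Context {R : realType}.

(** The first-order expansion, uniform over the entries. *)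
Lemma mx_is_derive_within_expand (k l : nat) (D : set R)
    (F : R -> 'M[R]_(k, l)) t dF c :
  mx_is_derive_within D F t dF -> 0 < c ->
  exists2 d, 0 < d & forall r, D r -> `|r - t| < d ->
    forall i j, `|(F r - F t - (r - t) *: dF) i j| <= c * `|r - t|.
Proof.
move=> FdF c0.
have : \forall r \near within D t^', forall i j,
    `|dF i j - (r - t)^-1 * (F r i j - F t i j)| <= c.
  apply: filter_forall => i; apply: filter_forall => j.
  by have /cvgrPdist_le/(_ _ c0) := FdF i j.
rewrite near_withinE near_withinE => /nbhs_normP[d /= d0 H].
exists d => // r Dr rt i j; rewrite !mxE.
have [->|rnt] := eqVneq r t.
  by rewrite !subrr mul0r subr0 normr0 mulr0.
have rt0 : r - t != 0 by rewrite subr_eq0.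
have := H r _ rnt Dr i j; rewrite /= distrC => /(_ rt).
rewrite -(ler_pM2r (_ : 0 < `|r - t|)) ?normr_gt0// -normrM.
congr (_ <= _); rewrite -normrN; congr `|_|; by field.
Qed.

Lemma mx_is_derive_within_continuous (k l : nat) a b (F : R -> 'M[R]_(k, l))
    (dF : R -> 'M[R]_(k, l)) :
  (forall t, t \in `[a, b] -> mx_is_derive_within `[a, b] F t (dF t)) ->
  forall i j, {within `[a, b], continuous (fun t => F t i j)}.
Proof.
move=> FdF i j; apply: dist_within_continuous => s as_ sb e e0.
have sab : s \in `[a, b] by rewrite in_itv/= as_ sb.
have [d d0 Fd] := mx_is_derive_within_expand (FdF s sab) ltr01.
pose K := `|dF s i j| + 1.
have K0 : 0 < K by rewrite ltr_pwDr.
exists (Num.min d (e / K)); first by rewrite lt_min d0 divr_gt0.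
move=> r ar rb; rewrite lt_min => /andP[rd re].
have rab : `[a, b]%classic r by rewrite /= in_itv/= ar rb.
have := Fd r rab rd i j; rewrite !mxE mul1r => H.
move: re; rewrite ltr_pdivlMr// => /ltW; apply: le_trans.
rewrite -[X in `|X|](subrK ((r - s) * dF s i j)).
apply: le_trans (ler_normD _ _) _; rewrite normrM /K mulrDr mulr1 addrC.
by rewrite lerD2l.
Qed.

Lemma within_continuous_cst (D : set R) (c : R) :
  {within D, continuous (fun _ : R => c)}.
Proof. by move=> x; exact: cvg_cst. Qed.

Lemma within_continuous_sum (D : set R) (I : finType) (F : I -> R -> R) :
  (forall i, {within D, continuous F i}) ->
  {within D, continuous (fun s => \sum_i F i s)}.
Proof.
move=> cF; elim: (index_enum I) => [|i r IH].
  under [X in continuous X]eq_fun do rewrite big_nil.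
  exact: within_continuous_cst.
under [X in continuous X]eq_fun do rewrite big_cons.
by move=> x; apply: cvgD; [exact: cF | exact: IH].
Qed.

End WithinContinuity.

(** * Quadratic forms and the Lyapunov operator *)

(** The bilinear form [a^T M b]; [bform 1%:M v v] is the squared Euclidean
    norm of [v]. *)
Definition bform (R : realType) (n : nat) (M : 'M[R]_n) (a b : 'cV[R]_n) : R :=
  (a^T *m M *m b) 0 0.

(** Nonnegativity of the quadratic form of [M], without symmetry. *)
Definition psd (R : realType) (n : nat) (M : 'M[R]_n) : Prop :=
  forall v, 0 <= bform M v v.

(** The entrywise l1 norm; it bounds the quadratic form of [M] by
    [bform_le_mxsum]. *)
Definition mxsum (R : realType) (n : nat) (M : 'M[R]_n) : R :=
  \sum_k \sum_l `|M k l|.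

(** The right-hand side of the Lyapunov equation. *)
Definition lyap (R : realType) (n m : nat) (A0 : 'M[R]_n) (A : 'I_m -> 'M[R]_n)
    (Z : 'M[R]_n) : 'M[R]_n :=
  A0^T *m Z + Z *m A0 + \sum_(i < m) (A i)^T *m Z *m A i.

Section BilinearForm.
Context {R : realType} {n : nat}.
Implicit Types (M N B : 'M[R]_n) (a b v w : 'cV[R]_n) (c : R).

Lemma bformE M a b : bform M a b = \sum_k \sum_l a k 0 * M k l * b l 0.
Proof.
rewrite /bform mxE exchange_big; apply: eq_bigr => l _.
rewrite mxE mulr_suml; apply: eq_bigr => k _; by rewrite mxE.
Qed.

Lemma bformDm M N a b : bform (M + N) a b = bform M a b + bform N a b.
Proof. by rewrite /bform mulmxDr mulmxDl mxE. Qed.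

Lemma bformZm c M a b : bform (c *: M) a b = c * bform M a b.
Proof. by rewrite /bform -scalemxAr -scalemxAl mxE. Qed.

Lemma bform_summ m (F : 'I_m -> 'M[R]_n) a b :
  bform (\sum_i F i) a b = \sum_i bform (F i) a b.
Proof. by rewrite /bform mulmx_sumr mulmx_suml summxE. Qed.

Lemma bformDl M a v b : bform M (a + v) b = bform M a b + bform M v b.
Proof. by rewrite /bform linearD !mulmxDl mxE. Qed.

Lemma bformZl c M a b : bform M (c *: a) b = c * bform M a b.
Proof. by rewrite /bform linearZ -!scalemxAl mxE. Qed.

Lemma bformBl M a v b : bform M (a - v) b = bform M a b - bform M v b.
Proof. by rewrite bformDl -scaleN1r bformZl mulN1r. Qed.

Lemma bformDr M a v b : bform M a (b + v) = bform M a b + bform M a v.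
Proof. by rewrite /bform mulmxDr mxE. Qed.

Lemma bformZr c M a b : bform M a (c *: b) = c * bform M a b.
Proof. by rewrite /bform -scalemxAr mxE. Qed.

Lemma bformBr M a v b : bform M a (b - v) = bform M a b - bform M a v.
Proof. by rewrite bformDr -scaleN1r bformZr mulN1r. Qed.

Lemma bform_mulr M B a b : bform M a (B *m b) = bform (M *m B) a b.
Proof. by rewrite /bform !mulmxA. Qed.

Lemma bform_mull M B a b : bform M (B *m a) b = bform (B^T *m M) a b.
Proof. by rewrite /bform trmx_mul !mulmxA. Qed.

Lemma bform_tr M a b : bform M^T a b = bform M b a.
Proof.
rewrite !bformE exchange_big; apply: eq_bigr => k _; apply: eq_bigr => l _.
by rewrite mxE mulrC mulrA mulrAC.
Qed.

Lemma bform_suml M m (F : 'I_m -> 'cV[R]_n) b :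
  bform M (\sum_i F i) b = \sum_i bform M (F i) b.
Proof. by rewrite /bform linear_sum !mulmx_suml summxE. Qed.

Lemma bform_sumr M m (F : 'I_m -> 'cV[R]_n) a :
  bform M a (\sum_i F i) = \sum_i bform M a (F i).
Proof. by rewrite /bform mulmx_sumr summxE. Qed.

(** The linear form [z |-> z^T M b + a^T M z] as a scalar product. *)
Lemma bform1_lin M a b z :
  bform 1%:M z (M *m b + M^T *m a) = bform M z b + bform M a z.
Proof. by rewrite bformDr !bform_mulr !mul1mx bform_tr. Qed.

Lemma bform1_sqr v : bform 1%:M v v = \sum_k v k 0 ^+ 2.
Proof.
by rewrite /bform mulmx1 mxE; apply: eq_bigr => k _; rewrite mxE expr2.
Qed.

Lemma bform1_ge0 v : 0 <= bform 1%:M v v.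
Proof. by rewrite bform1_sqr sumr_ge0// => k _; rewrite sqr_ge0. Qed.

Lemma mxsum_ge0 M : 0 <= mxsum M.
Proof. by apply: sumr_ge0 => k _; apply: sumr_ge0. Qed.

Lemma le_mxsum M c : (forall k l, `|M k l| <= c) ->
  mxsum M <= c * mxsum (const_mx 1 : 'M[R]_n).
Proof.
move=> Mc; rewrite mulr_sumr; apply: ler_sum => k _.
rewrite mulr_sumr; apply: ler_sum => l _.
by rewrite mxE normr1 mulr1.
Qed.

Lemma bform_le_mxsum M v : `|bform M v v| <= mxsum M * bform 1%:M v v.
Proof.
have le1 k : v k 0 ^+ 2 <= bform 1%:M v v.
  rewrite bform1_sqr (bigD1 k)//= lerDl sumr_ge0// => j _; exact: sqr_ge0.
rewrite bformE mulr_suml; apply: le_trans (ler_norm_sum _ _ _) _.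
apply: ler_sum => k _; rewrite mulr_suml.
apply: le_trans (ler_norm_sum _ _ _) _; apply: ler_sum => l _.
rewrite !normrM mulrAC mulrC ler_wpM2l// -normrM ler_norml.
have := le1 k; have := le1 l.
have := sqr_ge0 (v k 0 - v l 0); have := sqr_ge0 (v k 0 + v l 0).
by rewrite sqrrD sqrrB => *; apply/andP; split; nra.
Qed.

Lemma psdD M N : psd M -> psd N -> psd (M + N).
Proof. by move=> Mp Np v; rewrite bformDm addr_ge0. Qed.

Lemma psd_mxsum M c : mxsum M <= c -> psd (M + c *: 1%:M).
Proof.
move=> Mc v; rewrite bformDm bformZm.
have := bform_le_mxsum M v; rewrite ler_norml => /andP[h _].
have := ler_wpM2r (bform1_ge0 v) Mc; lra.
Qed.

(** The completion of the square [(B x - w x)^T M (B x - w x) >= 0], together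
    with the bound [|w| <= 1 + w^2] on the perturbation. *)
Lemma psd_cross M (B : 'M[R]_n) z (w g e : R) : psd M ->
  `|g - (bform M (B *m z) z + bform M z (B *m z))| <= e ->
  w * g <= bform M (B *m z) (B *m z) + w ^+ 2 * bform M z z + e * (1 + w ^+ 2).
Proof.
move=> Mp; set g0 := bform M (B *m z) z + _ => ge.
have := Mp (B *m z - w *: z).
rewrite bformBl !bformBr !bformZl !bformZr => sq.
have e0 : 0 <= e by apply: le_trans ge.
have : w * (g - g0) <= e * (1 + w ^+ 2).
  apply: le_trans (ler_norm _) _; rewrite normrM.
  apply: (@le_trans _ _ (`|w| * e)); first by rewrite ler_wpM2l.
  rewrite mulrC ler_wpM2l// -[w ^+ 2]real_normK ?num_real//.
  have := sqr_ge0 (`|w| - 1); have := normr_ge0 w.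
  by move=> *; nra.
by rewrite /g0 => ?; nra.
Qed.

Section Lyap.
Context {m : nat} (A0 : 'M[R]_n) (A : 'I_m -> 'M[R]_n).

Lemma lyapD M N : lyap A0 A (M + N) = lyap A0 A M + lyap A0 A N.
Proof.
rewrite /lyap !mulmxDr !mulmxDl.
under eq_bigr do rewrite mulmxDr mulmxDl.
by rewrite big_split /= (addrACA (A0^T *m M)) [LHS]addrACA.
Qed.

Lemma lyapZ c M : lyap A0 A (c *: M) = c *: lyap A0 A M.
Proof.
rewrite /lyap !scalerDr -!scalemxAr -!scalemxAl scaler_sumr.
by congr (_ + _); apply: eq_bigr => i _; rewrite -scalemxAr -scalemxAl.
Qed.

Lemma bform_lyap M a b : bform (lyap A0 A M) a b =
  bform M (A0 *m a) b + bform M a (A0 *m b)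
  + \sum_i bform M (A i *m a) (A i *m b).
Proof.
rewrite !bformDm bform_summ bform_mull bform_mulr; congr (_ + _).
by apply: eq_bigr => i _; rewrite bform_mull bform_mulr.
Qed.

(** One explicit Euler step preserves positivity up to second order, since
    [M + h L(M) + h^2 A0^T M A0] is the sum of [(1 + h A0)^T M (1 + h A0)] and
    of the [h A_i^T M A_i]. *)
Lemma psd_euler M h : 0 <= h -> psd M ->
  psd (M + h *: lyap A0 A M + h ^+ 2 *: (A0^T *m M *m A0)).
Proof.
move=> h0 Mp v.
have -> : bform (M + h *: lyap A0 A M + h ^+ 2 *: (A0^T *m M *m A0)) v v =
    bform M (v + h *: (A0 *m v)) (v + h *: (A0 *m v))
    + h * \sum_i bform M (A i *m v) (A i *m v).
  rewrite !bformDm !bformZm bform_lyap !bformDl !bformDr !bformZl !bformZr.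
  by rewrite -bform_mulr -bform_mull; ring.
by rewrite addr_ge0// mulr_ge0// sumr_ge0.
Qed.

End Lyap.
End BilinearForm.

Lemma enorm_sqr (R : realType) (k : nat) (v : 'cV[R]_k) :
  enorm v ^+ 2 = \sum_i v i 0 ^+ 2.
Proof. by rewrite /enorm sqr_sqrtr// sumr_ge0// => i _; exact: sqr_ge0. Qed.

Lemma bform_enorm (R : realType) (n p : nat) (C : 'M[R]_(p, n))
    (z : 'cV[R]_n) :
  bform (C^T *m C) z z = enorm (C *m z) ^+ 2.
Proof.
rewrite enorm_sqr /bform mulmxA -trmx_mul -mulmxA mxE.
by apply: eq_bigr => k _; rewrite mxE expr2.
Qed.

Lemma within_continuous_bform (R : realType) (n : nat) (D : set R)
    (M : R -> 'M[R]_n) (a b : R -> 'cV[R]_n) :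
  (forall k l, {within D, continuous (fun s => M s k l)}) ->
  (forall k, {within D, continuous (fun s => a s k 0)}) ->
  (forall k, {within D, continuous (fun s => b s k 0)}) ->
  {within D, continuous (fun s => bform (M s) (a s) (b s))}.
Proof.
move=> cM ca cb.
under [X in continuous X]eq_fun do rewrite bformE.
apply: within_continuous_sum => k; apply: within_continuous_sum => l x.
by apply: cvgM; [apply: cvgM; [exact: ca | exact: cM] | exact: cb].
Qed.

(** * Positivity of the Lyapunov flow *)

Section LyapPsd.
Context {R : realType} {n m : nat}.

(** Solutions of the Lyapunov equation stay positive semidefinite: for every
    [e > 0], the matrix [Z(s) + e exp(K s) I] stays in the cone, where the rate
    [K], larger than the size of [L(I)], leaves room for the
    second-order errors of an Euler step. *)
Lemma dual_lyapunov_psd (T : R) (A0 : 'M[R]_n) (A : 'I_m -> 'M[R]_n) Z0 Z :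
  dual_lyapunov_solution T A0 A Z0 Z -> psd Z0 ->
  forall s, 0 <= s -> s <= T -> psd (Z s).
Proof.
move=> [ZZ0 dZ] Z0p.
have cZ := mx_is_derive_within_continuous dZ.
pose K := mxsum (lyap A0 A 1%:M) + 1.
have K0 : 0 <= K by rewrite addr_ge0// mxsum_ge0.
suff main e : 0 < e -> forall s, 0 <= s -> s <= T ->
    psd (Z s + (e * expR (K * s)) *: 1%:M).
  (* It remains to let [e] tend to [0]. *)
  move=> s s0 sT v; apply/ler_addgt0Pr => e e0.
  pose c := expR (K * s) * bform 1%:M v v + 1.
  have c0 : 0 < c by rewrite ltr_pwDr// mulr_ge0 ?expR_ge0 ?bform1_ge0.
  have := main (e / c) (divr_gt0 e0 c0) s s0 sT v.
  rewrite bformDm bformZm => /le_trans; apply; rewrite lerD2l -mulrA.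
  rewrite mulrAC ler_pdivrMr// ler_pM2l// /c lerDl; lra.
move=> e0; apply: real_induction.
- apply: psdD; first by rewrite ZZ0.
  by move=> v; rewrite bformZm mulr_ge0 ?bform1_ge0// mulr_ge0 ?expR_ge0// ltW.
- move=> s s0 sT Zs.
  set c := e * expR (K * s) in Zs.
  have c0 : 0 < c by rewrite mulr_gt0// expR_gt0.
  set Y := Z s + c *: 1%:M in Zs.
  (* The steps are short enough for the expansion of [Z] and the second-order
     term to contribute at most [c h / 2] each. *)
  pose s2 := mxsum (A0^T *m Y *m A0).
  have s20 : 0 <= s2 := mxsum_ge0 _.
  pose N := mxsum (const_mx 1 : 'M[R]_n).
  have N0 : 0 <= N := mxsum_ge0 _.
  have sin : s \in `[0, T] by rewrite in_itv/= s0 ltW.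
  have k0 : 0 < c / (2 * (N + 1)) by rewrite divr_gt0// mulr_gt0//; lra.
  have [d d0 Zd] := mx_is_derive_within_expand (dZ s sin) k0.
  pose d' := c / (2 * (s2 + 1)).
  have d'0 : 0 < d' by rewrite divr_gt0// mulr_gt0//; lra.
  exists (Num.min d d'); first by rewrite lt_min d0.
  move=> r sr; rewrite -ltrBlDl lt_min => /andP[rd rd'] rT.
  have rin : `[0, T]%classic r by rewrite /= in_itv/= rT andbT; lra.
  set h := r - s in rd rd'.
  have h0 : 0 < h by rewrite subr_gt0.
  have nh : `|r - s| = h by rewrite gtr0_norm.
  have := Zd r rin; rewrite nh => /(_ rd).
  rewrite -/(lyap A0 A (Z s)) -/h; set Rm := _ - _ - _ => Rmd.
  have RmN : mxsum Rm <= c / 2 * h.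
    apply: le_trans (le_mxsum Rmd) _; rewrite -/N mulrAC ler_pM2r//.
    rewrite mulrAC ler_pdivrMr; last by rewrite mulr_gt0//; lra.
    have -> : c / 2 * (2 * (N + 1)) = c * (N + 1) by field.
    by rewrite ler_pM2l//; lra.
  pose c' := e * expR (K * r).
  have cc' : c + c * K * h <= c'.
    have -> : c' = c * expR (K * h).
      by rewrite /c' /c -mulrA -expRD; congr (_ * expR _); rewrite /h; ring.
    by rewrite -[X in X + _]mulr1 -mulrA -mulrDr ler_pM2l// expR_ge1Dx.
  (* With [Y = Z(s) + c I], an Euler step for [Y] plus four nonnegative
     corrections: for the remainder [Rm], the second-order term, [c h L(I)],
     and the surplus of [c'] over the first-order growth of [c]. *)
  have -> : Z r + c' *: 1%:M = (Y + h *: lyap A0 A Y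
        + h ^+ 2 *: (A0^T *m Y *m A0))
      + (Rm + (c / 2 * h) *: 1%:M)
      + h ^+ 2 *: (- (A0^T *m Y *m A0) + s2 *: 1%:M)
      + (c * h) *: (- lyap A0 A 1%:M + (K - 1) *: 1%:M)
      + (c' - (c + c * K * h) + (c / 2 * h - h ^+ 2 * s2)) *: 1%:M.
    rewrite /Rm {2}/Y lyapD lyapZ /Y.
    apply/matrixP => k l; rewrite !mxE.
    by field.
  have psdZ x M : 0 <= x -> psd M -> psd (x *: M).
    by move=> x0 Mp v; rewrite bformZm mulr_ge0.
  have mxsumN M : mxsum (- M) = mxsum M.
    by apply: eq_bigr => i _; apply: eq_bigr => j _; rewrite mxE normrN.
  apply: psdD; [apply: psdD; [apply: psdD; [apply: psdD|]|]|].
  + exact: psd_euler (ltW h0) Zs.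
  + exact: psd_mxsum.
  + by apply: psdZ; [exact: sqr_ge0 | apply: psd_mxsum; rewrite mxsumN].
  + apply: psdZ; first by rewrite mulr_ge0// ltW.
    by apply: psd_mxsum; rewrite mxsumN /K addrK.
  + apply: psdZ; last exact: bform1_ge0.
    rewrite addr_ge0 ?subr_ge0// expr2 -mulrA mulrC.
    rewrite [leRHS]mulrC -mulrA ler_pM2l//.
    move: rd'; rewrite /d' ltr_pdivlMr; last by rewrite mulr_gt0//; lra.
    by move=> ?; nra.
- move=> s s0 sT Zs v.
  pose f r := bform (Z r + (e * expR (K * r)) *: 1%:M) v v.
  apply: (@within_continuous_ge0_left _ f 0 T s) => //; last first.
    by move=> r r0 rs; exact: Zs.
  apply: within_continuous_bform => [k l|k|k]; try exact: within_continuous_cst.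
  under [X in continuous X]eq_fun do rewrite !mxE.
  move=> x; apply: cvgD; first exact: cZ.
  apply: cvgM; last exact: cvg_cst.
  apply: cvgM; first exact: cvg_cst.
  apply: continuous_subspaceT => y.
  apply: (@continuous_comp _ _ _ (fun y => K * y) expR).
    by apply: cvgM; [exact: cvg_cst|exact: cvg_id].
  exact: continuous_expR.
Qed.

End LyapPsd.

(** * Integrals of real functions *)

Section RealIntegrals.
Context {R : realType}.
Notation mu := (@lebesgue_measure R).
Notation rintegrable D f := (mu.-integrable D (EFin \o f)).

(* The Borel structure on [R] is made explicit in the measurability
   hypotheses, as several are declared on this type. *)
Lemma rintegrableD (D : set R) (f g : R -> R) :
  measurable (D : set (measurableTypeR R)) ->
  rintegrable D f -> rintegrable D g -> rintegrable D (fun x => f x + g x).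
Proof.
by move=> mD fi gi; apply: (eq_integrable mD _ _ _ (integrableD mD fi gi)).
Qed.

Lemma rintegrableZr (D : set R) (c : R) (f : R -> R) :
  measurable (D : set (measurableTypeR R)) ->
  rintegrable D f -> rintegrable D (fun x => f x * c).
Proof.
by move=> mD fi; apply: (eq_integrable mD _ _ _ (integrableZr mD c fi)).
Qed.

Lemma rintegrable_cst (a b : R) (c : R) : rintegrable `]a, b] (fun=> c).
Proof.
apply: (@integrableS _ _ _ mu `[a, b]%classic) => //.
  exact: subset_itv_oc_cc.
apply: continuous_compact_integrable; first exact: segment_compact.
exact: within_continuous_cst.
Qed.

Lemma rintegrable_sum (D : set R) (I : finType) (F : I -> R -> R) :
  measurable (D : set (measurableTypeR R)) -> (forall i, rintegrable D (F i)) ->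
  rintegrable D (fun x => \sum_i F i x).
Proof.
move=> mD Fi.
apply: (eq_integrable mD _ _ _ (@integrable_sum _ _ _ mu D mD I
  (index_enum I) xpredT (fun i => EFin \o F i) (fun i _ => Fi i))).
by move=> x _; rewrite /= sumEFin.
Qed.

Lemma Rintegral_sum (D : set R) (I : finType) (F : I -> R -> R) :
  measurable (D : set (measurableTypeR R)) -> (forall i, rintegrable D (F i)) ->
  Rintegral mu D (fun x => \sum_i F i x) = \sum_i Rintegral mu D (F i).
Proof.
move=> mD Fi; elim: (index_enum I) => [|i r IH].
  under eq_Rintegral do rewrite big_nil.
  by rewrite Rintegral_cst// mul0r big_nil.
under eq_Rintegral do rewrite big_cons.
rewrite RintegralD// ?IH ?big_cons//.
apply: (eq_integrable mD _ _ _ (@integrable_sum _ _ _ mu D mD I r xpredT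
  (fun i => EFin \o F i) (fun i _ => Fi i))).
by move=> x _; rewrite /= sumEFin.
Qed.

Lemma Rintegral_itvB_oc (f : R -> R) (a b s r : R) : rintegrable `[a, b] f ->
  a <= s -> s <= r -> r <= b ->
  rintegrable `]s, r] f /\
  Rintegral mu `[a, r] f - Rintegral mu `[a, s] f = Rintegral mu `]s, r] f.
Proof.
move=> fi as_ sr rb; split.
  apply: integrableS fi => //; apply: subset_itv; rewrite bnd_simp//.
by apply: Rintegral_itvB; rewrite ?bnd_simp//; apply: integrableS fi => //;
  apply: subset_itvl; rewrite bnd_simp.
Qed.

Lemma Rintegral_itv_oc_cst (c s r : R) : s <= r ->
  Rintegral mu `]s, r] (fun=> c) = c * (r - s).
Proof.
move=> sr; rewrite Rintegral_cst//; congr (_ * _).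
have := @lebesgue_measure_itv R `]s, r] => /= ->.
by rewrite lte_fin; case: ltgtP sr => //= -> _; rewrite subrr.
Qed.

Lemma continuous_rintegrable (a b : R) (g : R -> R) :
  {within `[a, b], continuous g} -> rintegrable `[a, b] g.
Proof.
move=> cg; apply: continuous_compact_integrable => //.
exact: segment_compact.
Qed.

(** Translation of the variable of integration. *)
Lemma integral_shift (a b : R) (g : R -> R) : a <= b ->
  {within `[0, b - a], continuous g} ->
  (\int[mu]_(t in `[a, b]) (g (t - a)%R)%:E =
   \int[mu]_(t in `[0%R, (b - a)%R]) (g t)%:E)%E.
Proof.
move=> ab cg.
have dF (t : R) : is_derive t 1 (fun t => t - a) 1.
  have := @is_deriveB _ _ _ id (cst a) t 1 1 0 _ _.
  by rewrite subr0; apply; exact: is_derive_id.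
have F' : derive1 (fun t : R => t - a) = cst 1.
  by apply/funext => t; rewrite derive1E; exact: derive_val.
have E0 : `[0, b - a]%classic = `[a - a, b - a]%classic :> set R.
  by rewrite subrr.
rewrite E0 in cg *.
rewrite (@integration_by_substitution_increasing R (fun t => t - a) g a b)//.
- by apply: eq_integral => t _; rewrite F' /= mulr1.
- by move=> x y _ _ xy; rewrite ltrD2r.
- by rewrite F' => t _; exact: cvg_cst.
- by rewrite F'; exact: is_cvg_cst.
- by rewrite F'; exact: is_cvg_cst.
have cF (t : R) : {for t, continuous (fun t => t - a)}.
  by apply: cvgB; [exact: cvg_id|exact: cvg_cst].
split=> [t _| |]; first exact: ex_derive.
- exact: cvg_at_right_filter (cF a).
- exact: cvg_at_left_filter (cF b).
Qed.

End RealIntegrals.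

(** * Controlled trajectories *)

(** The trajectory issued from [v] at time [t0]. *)
Definition state (R : realType) (n : nat) (Phi : R -> R -> 'M[R]_n) (t0 : R)
    (v : 'cV[R]_n) (s : R) : 'cV[R]_n := Phi s t0 *m v.

(** The vector field of the bilinear system under the control value [w]. *)
Definition velocity (R : realType) (n m : nat) (A0 : 'M[R]_n)
    (A : 'I_m -> 'M[R]_n) (w : 'cV[R]_m) (z : 'cV[R]_n) : 'cV[R]_n :=
  A0 *m z + \sum_(i < m) w i 0 *: (A i *m z).

Section State.
Context {R : realType} {n m : nat}.
Notation mu := (@lebesgue_measure R).
Notation rintegrable D f := (mu.-integrable D (EFin \o f)).
Context (T : R) (A0 : 'M[R]_n) (A : 'I_m -> 'M[R]_n) (u : R -> 'cV[R]_m).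
Context (Phi : R -> R -> 'M[R]_n).
Context (hPhi : fundamental_solution T A0 A u Phi).
Context (t0 : R) (v : 'cV[R]_n).
Context (t00 : 0 <= t0) (t0T : t0 <= T).

Local Notation x := (state Phi t0 v).
Local Notation y s := (velocity A0 A (u s) (x s)).

Let yE k : (fun s => y s k 0) = fun s => \sum_j (A0 *m Phi s t0) k j * v j 0
  + \sum_i \sum_j (u s i 0 *: (A i *m Phi s t0)) k j * v j 0.
Proof.
apply/funext => s.
rewrite /velocity /state mulmxA mxE mxE summxE; congr (_ + _).
by apply: eq_bigr => i _; rewrite mulmxA scalemxAl mxE.
Qed.

Lemma state_rintegrable k : rintegrable `[t0, T] (fun s => y s k 0).
Proof.
have [i0 i1 _] := hPhi t00 t0T (lexx T).
rewrite yE.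
apply: rintegrableD => //; apply: rintegrable_sum => // j.
  by apply: rintegrableZr => //; exact: i0.
by apply: rintegrable_sum => // l; apply: rintegrableZr => //; exact: i1.
Qed.

(** The integral equation for [Phi], applied to [v] and read in coordinates. *)
Lemma state_integralE r k : t0 <= r -> r <= T ->
  x r k 0 = v k 0 + Rintegral mu `[t0, r] (fun s => y s k 0).
Proof.
move=> tr rT; have [i0 i1 E] := hPhi t00 tr rT.
rewrite yE.
rewrite RintegralD//; last 2 first.
- by apply: rintegrable_sum => // j; apply: rintegrableZr => //; exact: i0.
- apply: rintegrable_sum => // i; apply: rintegrable_sum => // j.
  by apply: rintegrableZr => //; exact: i1.
rewrite Rintegral_sum//; last first.
  by move=> j; apply: rintegrableZr => //; exact: i0.
rewrite Rintegral_sum//; last first.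
  move=> i; apply: rintegrable_sum => // j.
  by apply: rintegrableZr => //; exact: i1.
rewrite /state E !mulmxDl mul1mx mxE [X in X + _ = _]mxE -addrA.
congr (_ + (_ + _)).
  rewrite mxE; apply: eq_bigr => j _; rewrite RintegralZr ?mxE//; exact: i0.
rewrite mulmx_suml summxE; apply: eq_bigr => i _.
rewrite Rintegral_sum//; last first.
  by move=> j; apply: rintegrableZr => //; exact: i1.
rewrite mxE; apply: eq_bigr => j _; rewrite RintegralZr ?mxE//; exact: i1.
Qed.

Lemma state_init : x t0 = v.
Proof.
apply/colP => k; rewrite state_integralE// set_itv1 Rintegral_set1 addr0//.
Qed.

Lemma state_continuous k : {within `[t0, T], continuous (fun s => x s k 0)}.
Proof.
have cI := parameterized_integral_continuous t0T (state_rintegrable k).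
apply: (@subspace_eq_continuous _ _ _
    (fun r => v k 0 + Rintegral mu `[t0, r] (fun s => y s k 0))).
  move=> r; rewrite inE /= in_itv/= => /andP[tr rT].
  exact/esym/state_integralE.
by move=> r; apply: cvgD; [exact: cvg_cst | exact: cI].
Qed.

Lemma state_increment (c : 'cV[R]_n) s r : t0 <= s -> s <= r -> r <= T ->
  rintegrable `]s, r] (fun z => bform 1%:M (y z) c) /\
  bform 1%:M (x r - x s) c = Rintegral mu `]s, r] (fun z => bform 1%:M (y z) c).
Proof.
move=> ts sr rT.
have bE (w : R -> 'cV[R]_n) :
    (fun z => bform 1%:M (w z) c) = fun z => \sum_k w z k 0 * c k 0.
  apply/funext => z; rewrite /bform mulmx1 mxE; apply: eq_bigr => k _.
  by rewrite mxE.
have bE' (w : 'cV[R]_n) : bform 1%:M w c = \sum_k w k 0 * c k 0.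
  by rewrite /bform mulmx1 mxE; apply: eq_bigr => k _; rewrite mxE.
have yi k : rintegrable `]s, r] (fun z => y z k 0).
  by have [] := Rintegral_itvB_oc (state_rintegrable k) ts sr rT.
rewrite bE bE'.
split.
  by apply: rintegrable_sum => // k; exact: rintegrableZr.
rewrite Rintegral_sum//; last by move=> k; exact: rintegrableZr.
apply: eq_bigr => k _; rewrite RintegralZr//; congr (_ * _).
have [_ <-] := Rintegral_itvB_oc (state_rintegrable k) ts sr rT.
have -> : (x r - x s) k 0 = x r k 0 - x s k 0 by rewrite !mxE.
rewrite !state_integralE//; last 2 first.
- exact: le_trans rT.
- exact: le_trans sr.
by rewrite opprD addrACA subrr add0r.
Qed.

End State.

(** * Growth of the energy along a trajectory *)

Section NearForms.
Context {R : realType} {n : nat}.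

(** Continuity of [(r1, r2) |-> x(r1)^T M x(r2)] on the diagonal, from the
    right. *)
Lemma bform_near_right (a b s e : R) (x : R -> 'cV[R]_n) (M : 'M[R]_n) :
  (forall k, {within `[a, b], continuous (fun r => x r k 0)}) ->
  a <= s -> s <= b -> 0 < e ->
  \forall d \near 0^'+, forall r1 r2, s <= r1 -> r1 <= s + d -> r1 <= b ->
    s <= r2 -> r2 <= s + d -> r2 <= b ->
    `|bform M (x r1) (x r2) - bform M (x s) (x s)| <= e.
Proof.
move=> cx as_ sb e0.
pose S := \sum_k \sum_l `|M k l| * (`|x s k 0| + `|x s l 0| + 1).
have S0 : 0 <= S.
  by do 2 apply: sumr_ge0 => ? _; rewrite mulr_ge0// !addr_ge0.
pose c := Num.min 1 (e / (S + 1)).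
have c0 : 0 < c by rewrite lt_min ltr01 divr_gt0// ltr_wpDl.
have c1 : c <= 1 by rewrite ge_min lexx.
have cS : c * S <= e.
  apply: (@le_trans _ _ (e / (S + 1) * S)).
    by rewrite ler_wpM2r// ge_min lexx orbT.
  by rewrite mulrAC ler_pdivrMr ?ltr_wpDl// ler_wpM2l ?(ltW e0)// lerDl.
have near_x : \forall d \near 0^'+, forall k r,
    s <= r -> r <= s + d -> r <= b -> `|x r k 0 - x s k 0| <= c.
  apply: filter_forall => k.
  have [d d0 xd] := within_continuous_dist (cx k) as_ sb c0.
  near=> d' => r sr rd rb; apply: xd => //; first exact: le_trans sr.
  rewrite ger0_norm ?subr_ge0// ltrBlDl; apply: le_lt_trans rd _.
  by rewrite ltrD2l; near: d'; exact: nbhs_right_lt.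
near=> d => r1 r2 sr1 r1d r1b sr2 r2d r2b.
have H k r : s <= r -> r <= s + d -> r <= b -> `|x r k 0 - x s k 0| <= c.
  by move: k r; near: d.
apply: le_trans cS; rewrite !bformE -sumrB mulr_sumr.
apply: le_trans (ler_norm_sum _ _ _) _; apply: ler_sum => k _.
rewrite -sumrB mulr_sumr.
apply: le_trans (ler_norm_sum _ _ _) _; apply: ler_sum => l _.
have -> : x r1 k 0 * M k l * x r2 l 0 - x s k 0 * M k l * x s l 0 =
  M k l * ((x r1 k 0 - x s k 0) * (x r2 l 0 - x s l 0)
    + (x r1 k 0 - x s k 0) * x s l 0 + x s k 0 * (x r2 l 0 - x s l 0)) by ring.
rewrite normrM mulrCA ler_wpM2l//.
have h1 := H k r1 sr1 r1d r1b; have h2 := H l r2 sr2 r2d r2b.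
apply: le_trans (ler_normD _ _) _.
apply: le_trans (lerD (ler_normD _ _) (lexx _)) _; rewrite !normrM.
have c0' := ltW c0.
have := ler_pM (normr_ge0 _) (normr_ge0 _) h1 (le_trans h2 c1).
have := ler_wpM2r (normr_ge0 (x s l 0)) h1.
have := ler_wpM2l (normr_ge0 (x s k 0)) h2.
lra.
Unshelve. all: by end_near. Qed.

End NearForms.

(** Gronwall's inequality in terms of increments: if, from each point on, [f]
    grows at most like [f dV] up to an arbitrarily small multiple of [dN], then
    [f <= exp(V) f(a)].  Nothing is differentiated. *)
Lemma gronwall_increment (R : realType) (a b : R) (f V N : R -> R) :
  {within `[a, b], continuous f} -> {within `[a, b], continuous V} ->
  {within `[a, b], continuous N} -> V a = 0 -> N a = 0 -> 0 <= f a ->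
  (forall s r, a <= s -> s <= r -> r <= b -> V s <= V r) ->
  (forall s r, a <= s -> s <= r -> r <= b -> N s <= N r) ->
  (forall e s, 0 < e -> a <= s -> s < b -> exists2 d, 0 < d &
    forall r, s < r -> r < s + d -> r <= b ->
      f r <= f s + f s * (V r - V s) + e * (N r - N s)) ->
  forall s, a <= s -> s <= b -> f s <= expR (V s) * f a.
Proof.
move=> cf cV cN Va Na fa Vm Nm step.
have main e : 0 < e -> forall s, a <= s -> s <= b ->
    f s <= expR (V s) * (f a + e * N s).
  move=> e0; apply: real_induction.
  - by rewrite Va Na expR0 mulr0 addr0 mul1r.
  - move=> s as_ sb fs; have [d d0 fd] := step e s e0 as_ sb.
    exists d => // r sr rd rb; apply: le_trans (fd r sr rd rb) _.
    have V0 : 0 <= V r - V s by rewrite subr_ge0 Vm// ltW.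
    have N0 : 0 <= N r - N s by rewrite subr_ge0 Nm// ltW.
    have Vr : 0 <= V r by rewrite -Va Vm// (le_trans as_)// ltW.
    have Ns : 0 <= N s by rewrite -Na Nm// ltW.
    have E1 : 1 <= expR (V r) by rewrite -expR0 ler_expR.
    have E2 : expR (V s) * (1 + (V r - V s)) <= expR (V r).
      have -> : expR (V r) = expR (V s) * expR (V r - V s).
        by rewrite -expRD addrCA subrr addr0.
      by rewrite ler_wpM2l ?expR_ge0// expR_ge1Dx.
    have g0 : 0 <= f a + e * N s by rewrite addr_ge0// mulr_ge0// ltW.
    apply: (@le_trans _ _ (expR (V r) * (f a + e * N s) + e * (N r - N s))).
      rewrite lerD2r -[X in X + _]mulr1 -mulrDr.
      apply: (@le_trans _ _ (expR (V s) * (f a + e * N s) * (1 + (V r - V s)))).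
        by rewrite ler_wpM2r// addr_ge0.
      by rewrite mulrAC ler_wpM2r.
    have eN : 0 <= e * (N r - N s) by rewrite mulr_ge0// ltW.
    have := ler_wpM2r eN E1; lra.
  - move=> s as_ sb fs; rewrite -subr_ge0.
    apply: (@within_continuous_ge0_left _
      (fun s => expR (V s) * (f a + e * N s) - f s) a b s) => //; last first.
      by move=> r ar rs; rewrite subr_ge0 fs.
    move=> z; apply: cvgB; last exact: cf.
    apply: cvgM.
      apply: (@cvg_comp _ _ _ V expR); first exact: cV.
      exact: continuous_expR.
    apply: cvgD; first exact: cvg_cst.
    by apply: cvgM; [exact: cvg_cst | exact: cN].
move=> s as_ sb; apply/ler_addgt0Pr => e e0.
have Ns : 0 <= N s by rewrite -Na Nm.
pose c := expR (V s) * N s + 1.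
have c0 : 0 < c by rewrite ltr_wpDl// mulr_ge0// expR_ge0.
apply: le_trans (main _ (divr_gt0 e0 c0) s as_ sb) _.
rewrite mulrDr lerD2l mulrCA mulrAC ler_pdivrMr// ler_pM2l//.
by rewrite /c lerDl.
Qed.

Section Energy.
Context {R : realType} {n m : nat}.
Notation mu := (@lebesgue_measure R).
Notation rintegrable D f := (mu.-integrable D (EFin \o f)).
Context (T : R) (A0 : 'M[R]_n) (A : 'I_m -> 'M[R]_n) (u : R -> 'cV[R]_m).
Context (hu : L2_control T u).
Context (Phi : R -> R -> 'M[R]_n).
Context (hPhi : fundamental_solution T A0 A u Phi).
Context (Z0 : 'M[R]_n) (Z : R -> 'M[R]_n).
Context (hZ : dual_lyapunov_solution T A0 A Z0 Z) (Z0p : psd Z0).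
Context (t0 t : R) (v : 'cV[R]_n).
Context (t00 : 0 <= t0) (t0t : t0 <= t) (tT : t <= T).

Local Notation x := (state Phi t0 v).
Local Notation w := (fun s : R => enorm (u s) ^+ 2).
Local Notation V r := (Rintegral mu `[t0, r] w).
Local Notation f := (fun s => bform (Z (t - s)) (x s) (x s)).

Let t0T : t0 <= T. Proof. exact: le_trans tT. Qed.

Let w_int : rintegrable `[t0, T] w.
Proof.
have [_ iw] := hu; apply: integrableS iw => //.
by apply: subset_itv; rewrite bnd_simp.
Qed.

(** One step of the energy estimate; [e] absorbs the replacement of the state
    at later times by [x s], and the remainder in the expansion of [Z]. *)
Lemma energy_increment e s : 0 < e -> t0 <= s -> s < t ->
  exists2 d, 0 < d & forall r, s < r -> r < s + d -> r <= t ->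
    f r <= f s + f s * (V r - V s)
      + e * ((V r + m.+2%:R * (r - t0)) - (V s + m.+2%:R * (s - t0))).
Proof.
move=> e0 ts st; have [h1 [h2 h3]] := (t00, (tT, t0t)).
have sT : s <= T by apply: ltW; exact: lt_le_trans tT.
have ts0 : 0 <= s by exact: le_trans ts.
have tsin : t - s \in `[0, T] by rewrite in_itv/=; apply/andP; split; lra.
set Zs := Z (t - s).
have Zp : psd Zs by apply: (dual_lyapunov_psd hZ Z0p); lra.
set L := lyap A0 A Zs.
pose B := bform 1%:M (x s) (x s).
have B0 : 0 <= B := bform1_ge0 _.
pose N := mxsum (const_mx 1 : 'M[R]_n).
have N0 : 0 <= N := mxsum_ge0 _.
(* With this rate the remainder in the expansion of [Z] costs [e h / 2]. *)
pose k := e / 2 / (N * (B + 1) + 1).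
have NB0 : 0 <= N * (B + 1) by rewrite mulr_ge0// addr_ge0.
have k0 : 0 < k by rewrite !divr_gt0// ltr_wpDl.
have [d1 d10 Zd] := mx_is_derive_within_expand (hZ.2 _ tsin) k0.
have e20 : 0 < e / 2 by rewrite divr_gt0.
have cx k' : {within `[t0, T], continuous (fun r => x r k' 0)}.
  exact: (state_continuous hPhi).
(* [close d c M]: on the right of [s] within distance [d], the form [M]
   evaluated along the trajectory moves by at most [c]. *)
pose close d c M := forall r1 r2, s <= r1 -> r1 <= s + d -> r1 <= T ->
  s <= r2 -> r2 <= s + d -> r2 <= T ->
  `|bform M (x r1) (x r2) - bform M (x s) (x s)| <= c.
have nearx M c : 0 < c -> \forall d \near 0^'+, close d c M.
  exact: bform_near_right.
have near_d : \forall d \near 0^'+, ((0 < d /\ d < d1) /\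
    (close d 1 1%:M /\ close d (e / 2) L)) /\
    ((close d (e / 2) (A0^T *m Zs) /\ close d (e / 2) (Zs *m A0)) /\
    forall i, close d (e / 2) ((A i)^T *m Zs) /\ close d (e / 2) (Zs *m A i)).
  have HA : \forall d \near 0^'+, forall i,
      close d (e / 2) ((A i)^T *m Zs) /\ close d (e / 2) (Zs *m A i).
    by apply: filter_forall => i; near=> d; split; near: d; exact: nearx.
  near=> d; split; [split; split | split; [split | by near: d]].
  - by near: d; exact: nbhs_right_gt.
  - by near: d; exact: nbhs_right_lt.
  - by near: d; exact: nearx.
  - by near: d; exact: nearx.
  - by near: d; exact: nearx.
  - by near: d; exact: nearx.
have [d [[[d0 dd1] [H1 HL]] [[HA0l HA0r] HA]]] := filter_ex near_d.
exists d => // r sr rd rt.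
have rT : r <= T by exact: le_trans tT.
have sr' := ltW sr; have rd' := ltW rd.
set h := r - s.
have h0 : 0 < h by rewrite subr_gt0.
have trin : `[0, T]%classic (t - r).
  by rewrite /= in_itv/=; apply/andP; split; lra.
have hE : t - r - (t - s) = - h by rewrite /h; ring.
have := Zd (t - r) trin; rewrite hE normrN (gtr0_norm h0).
have hd1 : h < d1 by rewrite /h; lra.
move=> /(_ hd1); rewrite -/Zs -/(lyap A0 A Zs) -/L; set Rm := _ - _ - _ => Rmk.
have {H1}HB := H1 r r sr' rd' rT sr' rd' rT.
have {}HL := HL r r sr' rd' rT sr' rd' rT.
(* The variation of [Z], at the fixed state [x r]. *)
have T1 : bform (Z (t - r)) (x r) (x r) - bform Zs (x r) (x r)
    <= - h * bform L (x s) (x s) + e * h.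
  have -> : Z (t - r) = Zs - h *: L + Rm.
    apply/matrixP => i j; rewrite !mxE; ring.
  rewrite -scaleNr (bformDm (Zs + _) Rm) (bformDm Zs) bformZm.
  have := bform_le_mxsum Rm (x r); rewrite ler_norml => /andP[_ R1].
  have R2 : mxsum Rm * bform 1%:M (x r) (x r) <= e / 2 * h.
    apply: (@le_trans _ _ (k * h * N * (B + 1))).
      apply: ler_pM; rewrite ?mxsum_ge0 ?bform1_ge0//; first exact: le_mxsum.
      by move: HB; rewrite ler_norml => /andP[_]; rewrite -/B; lra.
    have -> : k * h * N * (B + 1) = k * (N * (B + 1)) * h by ring.
    rewrite ler_pM2r// /k mulrAC ler_pdivrMr ?ltr_wpDl//.
    by rewrite ler_pM2l// lerDl.
  move: HL; rewrite ler_norml => /andP[HL _].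
  have := ler_wpM2l (ltW h0) HL; lra.
(* The variation of the state, at the fixed matrix [Zs]: an integral of
   [G A0 + sum_i u_i G (A i)], whose integrand is bounded pointwise by
   completing squares. *)
pose c := Zs *m x r + Zs^T *m x s.
have [gi gE] := state_increment hPhi v t00 t0T c ts sr' rT.
pose G (M : 'M[R]_n) a b z := bform Zs (M *m z) b + bform Zs a (M *m z).
pose S1 := \sum_i bform Zs (A i *m x s) (A i *m x s).
have LE : bform L (x s) (x s) = G A0 (x s) (x s) (x s) + S1.
  by rewrite bform_lyap.
have closeG M z : close d (e / 2) (M^T *m Zs) -> close d (e / 2) (Zs *m M) ->
    s < z -> z <= r ->
    `|G M (x s) (x r) (x z) - G M (x s) (x s) (x s)| <= e.
  move=> Hl Hr sz zr.
  have zd : z <= s + d by exact: le_trans rd'.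
  have zT : z <= T by exact: le_trans rT.
  have sd : s <= s + d by rewrite lerDl ltW.
  have GE a b y : G M a b y = bform (M^T *m Zs) y b + bform (Zs *m M) a y.
    by rewrite /G bform_mull bform_mulr.
  rewrite !GE.
  have := Hl z r (ltW sz) zd zT sr' rd' rT.
  have := Hr s z (lexx s) sd sT (ltW sz) zd zT.
  rewrite !ler_norml => /andP[? ?] /andP[? ?]; apply/andP; split; lra.
pose c1 := bform L (x s) (x s) + e * m.+1%:R.
pose P := bform Zs (x s) (x s).
have g_le z : s < z -> z <= r ->
    bform 1%:M (velocity A0 A (u z) (x z)) c <= c1 + w z * (P + e).
  move=> sz zr; rewrite bform1_lin /velocity bformDl bformDr addrACA.
  rewrite bform_suml bform_sumr -big_split /= -/(G A0 _ _ _) /c1 LE.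
  have := closeG A0 z HA0l HA0r sz zr; rewrite ler_norml => /andP[_ g0].
  have : \sum_(i < m) (bform Zs (u z i 0 *: (A i *m x z)) (x r)
      + bform Zs (x s) (u z i 0 *: (A i *m x z))) <=
    \sum_(i < m) (bform Zs (A i *m x s) (A i *m x s) + u z i 0 ^+ 2 * P
      + e * (1 + u z i 0 ^+ 2)).
    apply: ler_sum => i _; rewrite bformZl bformZr -mulrDr.
    have [HAl HAr] := HA i.
    exact: psd_cross (closeG (A i) z HAl HAr sz zr).
  rewrite !big_split /= -mulr_suml -/S1 -mulr_sumr big_split /=.
  rewrite -enorm_sqr sumr_const card_ord -[m.+1]addn1 natrD; lra.
have [wi wE] := Rintegral_itvB_oc w_int ts sr' rT.
have T2 : bform Zs (x r) (x r) - bform Zs (x s) (x s) <=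
    c1 * h + (V r - V s) * (P + e).
  have -> : bform Zs (x r) (x r) - bform Zs (x s) (x s)
      = bform 1%:M (x r - x s) c.
    by rewrite bform1_lin bformBl bformBr; ring.
  rewrite gE wE -RintegralZr// -Rintegral_itv_oc_cst//.
  rewrite -RintegralD//; last 2 first.
  - exact: rintegrable_cst.
  - exact: rintegrableZr.
  apply: le_Rintegral => //.
  - by apply: rintegrableD => //; [exact: rintegrable_cst|exact: rintegrableZr].
  - by move=> z; rewrite /= in_itv/= => /andP[sz zr]; exact: g_le.
move: T1 T2; rewrite /c1 -/P -[m.+2]addn1 natrD /h; lra.
Unshelve. all: by end_near. Qed.

Lemma control_energy_continuous : {within `[t0, t], continuous (fun r => V r)}.
Proof.
apply: (@continuous_subspaceW _ _ _ `[t0, T]%classic).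
  by apply: subset_itvl; rewrite bnd_simp.
exact: parameterized_integral_continuous.
Qed.

Lemma control_energy_nondecreasing s r :
  t0 <= s -> s <= r -> r <= T -> V s <= V r.
Proof.
move=> ts sr rT; rewrite -subr_ge0.
have [_ ->] := Rintegral_itvB_oc w_int ts sr rT.
by apply: Rintegral_ge0 => z _; exact: sqr_ge0.
Qed.

Lemma energy_continuous : {within `[t0, t], continuous f}.
Proof.
have cx k : {within `[t0, t], continuous (fun r => x r k 0)}.
  apply: (@continuous_subspaceW _ _ _ `[t0, T]%classic).
    by apply: subset_itvl; rewrite bnd_simp.
  exact: (state_continuous hPhi).
apply: within_continuous_bform => // k l.
have cZ : {within `[0, T], continuous (fun s => Z s k l)}.
  exact: (mx_is_derive_within_continuous hZ.2).
have [h1 [h2 h3]] := (t00, (tT, t0t)).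
apply: dist_within_continuous => s ts st e e0.
have ts0 : 0 <= t - s by lra.
have tsT : t - s <= T by lra.
have [d d0 Zd] := within_continuous_dist cZ ts0 tsT e0.
exists d => // r tr rt rs; apply: Zd; [lra|lra|].
by rewrite (_ : _ - _ = - (r - s)) ?normrN//; ring.
Qed.

(** The pointwise form of the result: with [Z0 = C^T C] the left-hand side is
    [|C x(t)|^2]. *)
Lemma energy_bound :
  bform Z0 (x t) (x t) <= expR (L2_sqnorm T u) * bform (Z (t - t0)) v v.
Proof.
have [h1 [h2 h3]] := (t00, (tT, t0t)).
have Zp : psd (Z (t - t0)) by apply: (dual_lyapunov_psd hZ Z0p); lra.
have V0 : V t0 = 0 by rewrite set_itv1 Rintegral_set1.
have cN : {within `[t0, t],
    continuous (fun s => V s + m.+2%:R * (s - t0))}.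
  move=> s; apply: cvgD; first exact: control_energy_continuous.
  apply: cvgM; first exact: cvg_cst.
  apply: cvgB; last exact: cvg_cst.
  by apply: continuous_subspaceT => z; exact: cvg_id.
have : f t <= expR (V t) * f t0.
  apply: (gronwall_increment energy_continuous control_energy_continuous cN V0)
    => //.
  - by rewrite V0 subrr mulr0 addr0.
  - move=> s r ts sr rt; apply: control_energy_nondecreasing => //.
    exact: le_trans tT.
  - move=> s r ts sr rt; rewrite lerD//.
      by apply: control_energy_nondecreasing => //; exact: le_trans tT.
    by rewrite ler_wpM2l// lerD2r.
  - by move=> e s e0 ts st; exact: energy_increment.
rewrite /= subrr hZ.1 (state_init hPhi)// => /le_trans; apply.
rewrite ler_wpM2r// ler_expR.
have [_ iw] := hu.
apply: le_trans (control_energy_nondecreasing h3 h2 (lexx T)) _.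
have [iw' E] := Rintegral_itvB_oc iw t00 t0T (lexx T).
rewrite -Rintegral_itv_obnd_cbnd// -E gerBl.
by apply: Rintegral_ge0 => z _; exact: sqr_ge0.
Qed.

End Energy.

(** * The bound on the output energy *)

Section Gramian.
Context {R : realType}.
Notation mu := (@lebesgue_measure R).
Notation rintegrable D f := (mu.-integrable D (EFin \o f)).

Lemma obs_gramian_bform (n : nat) (T : R) (Z : R -> 'M[R]_n) (v : 'cV[R]_n) :
  (forall k l, {within `[0, T], continuous (fun s => Z s k l)}) ->
  bform (obs_gramian T Z) v v = Rintegral mu `[0, T] (fun s => bform (Z s) v v).
Proof.
move=> cZ; under eq_Rintegral do rewrite bformE.
have iZ k l : rintegrable `[0, T] (fun s => v k 0 * Z s k l * v l 0).
  apply: continuous_rintegrable => x; apply: cvgM; last exact: cvg_cst.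
  by apply: cvgM; [exact: cvg_cst | exact: cZ].
rewrite bformE Rintegral_sum//; last by move=> k; exact: rintegrable_sum.
apply: eq_bigr => k _; rewrite Rintegral_sum//; apply: eq_bigr => l _.
rewrite mxE RintegralZr ?RintegralZl//.
  exact: continuous_rintegrable.
apply: continuous_rintegrable => x.
by apply: cvgM; [exact: cvg_cst | exact: cZ].
Qed.

End Gramian.

Theorem proposition4p4 (R : realType) (n m p : nat) (T : R) (hT : 0 < T)
    (A0 : 'M[R]_n) (A : 'I_m -> 'M[R]_n) (C : 'M[R]_(p, n))
    (u : R -> 'cV[R]_m) (hu : L2_control T u)
    (Phi : R -> R -> 'M[R]_n) (hPhi : fundamental_solution T A0 A u Phi)
    (Z : R -> 'M[R]_n) (hZ : dual_lyapunov_solution T A0 A (C^T *m C) Z)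
    (q : 'I_n -> 'cV[R]_n) (mu : 'I_n -> R)
    (hq : orthonormal_eigenbasis (obs_gramian T Z) mu q) :
  forall (i : 'I_n) (t0 : R), 0 <= t0 -> t0 < T ->
  (\int[lebesgue_measure]_(t in `[t0, T])
      (enorm (C *m Phi t t0 *m q i) ^+ 2)%:E
    <= (mu i * expR (L2_sqnorm T u))%:E)%E.
Proof.
move=> i t0 t00 t0T; have t0T' := ltW t0T; have [_ on ev] := hq.
set v := q i.
have CCp : psd (C^T *m C) by move=> z; rewrite bform_enorm sqr_ge0.
have Zp := dual_lyapunov_psd hZ CCp.
pose E := expR (L2_sqnorm T u).
have E0 : 0 <= E := expR_ge0 _.
pose g s := bform (Z s) v v.
have cZ k l : {within `[0, T], continuous (fun s => Z s k l)}.
  exact: (mx_is_derive_within_continuous hZ.2).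
have cg : {within `[0, T], continuous g}.
  by apply: within_continuous_bform => // k; exact: within_continuous_cst.
have sub0 : `[0, T - t0] `<=` (`[0, T] : set R).
  by apply: subset_itvl; rewrite bnd_simp lerBlDr lerDl.
have cg0 : {within `[0, T - t0], continuous g}.
  exact: continuous_subspaceW cg.
have cgs : {within `[t0, T], continuous (fun t => g (t - t0))}.
  apply: dist_within_continuous => s ts sT e e0.
  have s0 : 0 <= s - t0 by lra.
  have s1 : s - t0 <= T by lra.
  have [d d0 gd] := within_continuous_dist cg s0 s1 e0.
  exists d => // r tr rT rs; apply: gd; [lra|lra|].
  by rewrite opprB addrA subrK.
pose y t := bform (C^T *m C) (state Phi t0 v t) (state Phi t0 v t).
have cx k : {within `[t0, T], continuous (fun r => state Phi t0 v r k 0)}.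
  exact: (state_continuous hPhi).
have cy : {within `[t0, T], continuous y}.
  by apply: within_continuous_bform => // k l; exact: within_continuous_cst.
have yE t : enorm (C *m Phi t t0 *m v) ^+ 2 = y t.
  by rewrite /y bform_enorm /state mulmxA.
(* The pointwise bound is integrated, then translated, and [g >= 0] allows the
   domain to grow up to [T]. *)
under eq_integral do rewrite yE.
have y0 t : 0 <= y t by exact: CCp.
apply: (@le_trans _ _ (\int[lebesgue_measure]_(t in `[t0, T])
    (E%:E * (g (t - t0)%R)%:E))%E).
  apply: ge0_le_integral => //.
  - by move=> t _; rewrite lee_fin.
  - by have /integrableP[] := continuous_rintegrable cy.
  - have igs := continuous_rintegrable cgs.
    have mD : measurable (`[t0, T]%classic : set (measurableTypeR R)) by [].
    by have /integrableP[] := integrableZl mD E igs.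
  - move=> t; rewrite /= in_itv/= => /andP[t1 t2].
    rewrite -EFinM lee_fin; exact: (energy_bound hu hPhi hZ).
rewrite integralZl//; last exact: continuous_rintegrable.
rewrite mulrC EFinM lee_wpmul2l ?lee_fin// integral_shift//.
apply: (@le_trans _ _ (\int[lebesgue_measure]_(t in `[0%R, T]) (g t)%:E)%E).
  apply: ge0_subset_integral => //.
  - by have /integrableP[] := continuous_rintegrable cg.
  - by move=> t; rewrite /= in_itv/= lee_fin => /andP[? ?]; exact: Zp.
have ig := continuous_rintegrable cg.
rewrite -(fineK (integrable_fin_num _ ig))// lee_fin.
rewrite -[leLHS]/(Rintegral lebesgue_measure `[0, T] g) -obs_gramian_bform//.
rewrite /bform -mulmxA ev -scalemxAr mxE on eqxx mulr1//.
Qed.
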